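(* Let $k$ be a field, $(H,\alpha)$ a monoidal Hom-Hopf algebra over $k$ with invertible antipode $S$, $(M,\mu)$ a left-covariant $(H,\alpha)$-Hom-bimodule, and $\{m_i\}_{i\in I}$ a $k$-linear basis of ${}^{coH}M$. Write $\mu(m_i)=\mu^i_jm_j$ and $\mu^{-1}(m_i)=\bar\mu^i_jm_j$ with $\mu^i_j,\bar\mu^i_j\in k$. Then $\{m_i\}_{i\in I}$ is a free left $(H,\alpha)$-Hom-module basis of $M$, and there exists a pointwise finite matrix $(f^i_j)_{i,j\in I}$ of linear functionals $f^i_j\in H'=\mathrm{Hom}(H,k)$ such that for all $h,g\in H$ and all indices $$\mu^i_jf^j_k(hg)=f^i_j(h)f^j_k(\alpha(g)),\qquad f^i_j(1_H)=\mu^i_j,$$ $$m_ih=(\bar\mu^i_jf^j_k\bullet\alpha^{-1}(h))m_k.$$ Moreover, $\{m_i\}_{i\in I}$ is a free right $(H,\alpha)$-Hom-module basis of $M$, and $$hm_i=m_j\big(((\bar\mu^i_kf^k_j)\circ S^{-1})\bullet\alpha^{-1}(h)\big).$$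
   Context: Conventions: $\otimes=\otimes_k$; Sweedler notation without summation signs; repeated indices are summed over $I$. $\widetilde{\mathcal{H}}(\mathcal{M}_k)$ is the category of pairs $(M,\mu)$, $M$ a $k$-module, $\mu$ a $k$-linear automorphism of $M$; morphisms $f:(M,\mu)\to(N,\nu)$ are $k$-linear maps with $\nu f=f\mu$; $(M,\mu)\otimes(N,\nu)=(M\otimes N,\mu\otimes\nu)$. A monoidal Hom-Hopf algebra $(H,\alpha)$ is an object of $\widetilde{\mathcal{H}}(\mathcal{M}_k)$ with a $k$-bilinear product, an element $1_H$, and $k$-linear maps $\Delta(h)=h_1\otimes h_2$, $\varepsilon:H\to k$, $S:H\to H$ (antipode) such that $\alpha(ab)=\alpha(a)\alpha(b)$, $\alpha(1_H)=1_H$, $\alpha(a)(bc)=(ab)\alpha(c)$, $a1_H=1_Ha=\alpha(a)$; $\Delta(\alpha(c))=\alpha(c_1)\otimes\alpha(c_2)$, $\varepsilon\alpha=\varepsilon$, $\alpha^{-1}(c_1)\otimes\Delta(c_2)=c_{11}\otimes(c_{12}\otimes\alpha^{-1}(c_2))$, $c_1\varepsilon(c_2)=\alpha^{-1}(c)=\varepsilon(c_1)c_2$; $\Delta(ab)=\Delta(a)\Delta(b)$, $\Delta(1_H)=1_H\otimes1_H$, $\varepsilon(ab)=\varepsilon(a)\varepsilon(b)$, $\varepsilon(1_H)=1$; $S\alpha=\alpha S$ and $S(h_1)h_2=\varepsilon(h)1_H=h_1S(h_2)$. All actions and coactions are morphisms in $\widetilde{\mathcal{H}}(\mathcal{M}_k)$.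 Hom-bimodule $(M,\mu)$: $\alpha(g)(hm)=(gh)\mu(m)$, $1_Hm=\mu(m)$, $(mg)\alpha(h)=\mu(m)(gh)$, $m1_H=\mu(m)$, $(gm)\alpha(h)=\alpha(g)(mh)$. Left Hom-comodule, $\rho(m)=m_{(-1)}\otimes m_{(0)}$: $\Delta(m_{(-1)})\otimes\mu^{-1}(m_{(0)})=(\alpha^{-1}(m_{(-1)})\otimes m_{(0)(-1)})\otimes m_{(0)(0)}$, $\varepsilon(m_{(-1)})m_{(0)}=\mu^{-1}(m)$. A left-covariant $(H,\alpha)$-Hom-bimodule is a Hom-bimodule with a left Hom-coaction $\rho$ such that $\rho((hm)\alpha(g))=\Delta(\alpha(h))(\rho(m)\Delta(g))$ (componentwise actions). ${}^{coH}M=\{m\in M:\rho(m)=1_H\otimes\mu^{-1}(m)\}$, which is stable under $\mu$ and $\mu^{-1}$. For $f\in H'$, $h\in H$: $f\bullet h=\alpha^2(h_1)f(\alpha(h_2))$. A matrix $(f^i_j)$ of functionals is pointwise finite if for each $i\in I$ and $h\in H$ all but finitely many $f^i_j(h)$, $j\in I$, vanish. $\{m_i\}$ is a free left (right) Hom-module basis of $M$ if every $m\in M$ can be written uniquely as $\sum_ih_im_i$ (respectively $\sum_im_ih_i$) with $h_i\in H$, all but finitely many zero. *)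

(* Defs.v *)
From HB Require Import structures.
From mathcomp Require Import all_boot all_order all_algebra.
From mathcomp Require Import boolp classical_sets functions cardinality fsbigop.

Set Implicit Arguments.
Unset Strict Implicit.
Unset Printing Implicit Defensive.
Import GRing.Theory.
Local Open Scope quotient_scope.
Local Open Scope ring_scope.

Reserved Notation "u ⊗ v" (at level 40, left associativity).

(* The tensor product of two modules over a commutative ring: finite formal  *)
(* sums of pairs (u, v), modulo the least congruence making (u, v) bilinear. *)

Inductive tensor_rel (K : comNzRingType) (U V : lmodType K) :
    seq (U * V) -> seq (U * V) -> Prop :=
| tensor_rel_refl s : tensor_rel s s
| tensor_rel_sym s t : tensor_rel s t -> tensor_rel t s
| tensor_rel_trans s t r : tensor_rel s t -> tensor_rel t r -> tensor_rel s r
| tensor_rel_cat s s' t t' :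
    tensor_rel s s' -> tensor_rel t t' -> tensor_rel (s ++ t) (s' ++ t')
| tensor_rel_catC s t : tensor_rel (s ++ t) (t ++ s)
| tensor_rel_0l v : tensor_rel [:: (0, v)] [::]
| tensor_rel_Dl u u' v : tensor_rel [:: (u + u', v)] [:: (u, v); (u', v)]
| tensor_rel_Dr u v v' : tensor_rel [:: (u, v + v')] [:: (u, v); (u, v')]
| tensor_rel_Z a u v : tensor_rel [:: (a *: u, v)] [:: (u, a *: v)].

Section TensorProduct.
Variables (K : comNzRingType) (U V : lmodType K).
Local Notation rel := (@tensor_rel K U V).

Definition tensor_eqv (s t : seq (U * V)) : bool := `[< rel s t >].

Lemma tensor_eqv_refl : reflexive tensor_eqv.
Proof. by move=> s; apply/asboolP; exact: tensor_rel_refl. Qed.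

Lemma tensor_eqv_sym : symmetric tensor_eqv.
Proof. by move=> s t; apply/asboolP/asboolP; exact: tensor_rel_sym. Qed.

Lemma tensor_eqv_trans : transitive tensor_eqv.
Proof.
move=> t s r /asboolP st /asboolP tr; apply/asboolP.
exact: tensor_rel_trans st tr.
Qed.

Canonical tensor_equiv :=
  EquivRel tensor_eqv tensor_eqv_refl tensor_eqv_sym tensor_eqv_trans.

Definition tensor : Type := {eq_quot tensor_equiv}.

HB.instance Definition _ := Choice.on tensor.
HB.instance Definition _ := EqQuotient.on tensor.

Definition tensor_class (s : seq (U * V)) : tensor := \pi_tensor s.

(* A choice of simple tensors adding up to t: the pairs (t_1, t_2) of        *)
(* Sweedler's notation.                                                      *)
Definition sweedler (t : tensor) : seq (U * V) := repr t.

Lemma tensor_classP s t : tensor_class s = tensor_class t <-> rel s t.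
Proof.
split=> [/eqP|st]; last by apply/eqmodP/asboolP.
by rewrite /tensor_class eqmodE => /asboolP.
Qed.

Lemma sweedlerK t : tensor_class (sweedler t) = t.
Proof. exact: reprK. Qed.

Lemma sweedler_class s : rel (sweedler (tensor_class s)) s.
Proof. by apply/tensor_classP; rewrite sweedlerK. Qed.

Definition scale_terms (a : K) (s : seq (U * V)) := [seq (a *: p.1, p.2) | p <- s].

Lemma tensor_rel_scale a s t :
  rel s t -> rel (scale_terms a s) (scale_terms a t).
Proof.
elim=> {s t} [s|s t _ IH|s t r _ IH1 _ IH2|s s' t t' _ IH1 _ IH2|s t|v|u u' v
  |u v v'|b u v] /=.
- exact: tensor_rel_refl.
- exact: tensor_rel_sym.
- exact: tensor_rel_trans IH1 IH2.
- by rewrite /scale_terms !map_cat; exact: tensor_rel_cat.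
- by rewrite /scale_terms !map_cat; exact: tensor_rel_catC.
- by rewrite scaler0; exact: tensor_rel_0l.
- by rewrite scalerDr; exact: tensor_rel_Dl.
- exact: tensor_rel_Dr.
- by rewrite scalerA mulrC -scalerA; exact: tensor_rel_Z.
Qed.

Definition tensor_zero : tensor := tensor_class [::].
Definition tensor_add (x y : tensor) : tensor :=
  tensor_class (sweedler x ++ sweedler y).
Definition tensor_scale (a : K) (x : tensor) : tensor :=
  tensor_class (scale_terms a (sweedler x)).
Definition tensor_opp (x : tensor) : tensor := tensor_scale (-1) x.

Lemma tensor_ind (P : tensor -> Prop) :
  (forall s, P (tensor_class s)) -> forall t, P t.
Proof. by move=> Ps t; rewrite -(sweedlerK t). Qed.

Lemma tensor_addE s t :
  tensor_add (tensor_class s) (tensor_class t) = tensor_class (s ++ t).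
Proof. by apply/tensor_classP/tensor_rel_cat; exact: sweedler_class. Qed.

Lemma tensor_scaleE a s :
  tensor_scale a (tensor_class s) = tensor_class (scale_terms a s).
Proof. by apply/tensor_classP/tensor_rel_scale; exact: sweedler_class. Qed.

Lemma tensor_addA : associative tensor_add.
Proof.
elim/tensor_ind=> s; elim/tensor_ind=> t; elim/tensor_ind=> r.
by rewrite !tensor_addE catA.
Qed.

Lemma tensor_addC : commutative tensor_add.
Proof.
elim/tensor_ind=> s; elim/tensor_ind=> t; rewrite !tensor_addE.
by apply/tensor_classP; exact: tensor_rel_catC.
Qed.

Lemma tensor_add0 : left_id tensor_zero tensor_add.
Proof. by elim/tensor_ind=> s; rewrite tensor_addE. Qed.

Lemma tensor_scaleDl x a b :
  tensor_scale (a + b) x = tensor_add (tensor_scale a x) (tensor_scale b x).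
Proof.
elim/tensor_ind: x => s; rewrite !tensor_scaleE.
elim: s => [|[u v] s IH]; first by rewrite tensor_addE.
have E c : tensor_class (scale_terms c ((u, v) :: s)) =
    tensor_add (tensor_class [:: (c *: u, v)]) (tensor_class (scale_terms c s)).
  by rewrite tensor_addE.
rewrite !E IH scalerDl.
have -> : tensor_class [:: (a *: u + b *: u, v)] =
    tensor_add (tensor_class [:: (a *: u, v)]) (tensor_class [:: (b *: u, v)]).
  by rewrite tensor_addE; apply/tensor_classP; exact: tensor_rel_Dl.
set p := tensor_class [:: _]; set q := tensor_class [:: _].
set x := tensor_class _; set y := tensor_class _.
by rewrite -!tensor_addA; congr tensor_add; rewrite !tensor_addA (tensor_addC q).
Qed.

Lemma tensor_scale0 x : tensor_scale 0 x = tensor_zero.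
Proof.
elim/tensor_ind: x => s; rewrite tensor_scaleE.
apply/tensor_classP; elim: s => [|[u v] s IH]; first exact: tensor_rel_refl.
rewrite -[X in rel _ X]/([::] ++ [::]).
apply: (@tensor_rel_cat _ _ _ [:: _]) IH.
by rewrite scale0r; exact: tensor_rel_0l.
Qed.

Lemma tensor_scale1 : left_id 1 tensor_scale.
Proof.
elim/tensor_ind=> s; rewrite tensor_scaleE; congr tensor_class.
by rewrite -[RHS]map_id; apply: eq_map => -[u v] /=; rewrite scale1r.
Qed.

Lemma tensor_addN : left_inverse tensor_zero tensor_opp tensor_add.
Proof.
move=> x; rewrite -{2}(tensor_scale1 x) /tensor_opp -tensor_scaleDl.
by rewrite addNr tensor_scale0.
Qed.

HB.instance Definition _ := GRing.isZmodule.Build tensor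
  tensor_addA tensor_addC tensor_add0 tensor_addN.

Lemma tensor_scaleA a b x :
  tensor_scale a (tensor_scale b x) = tensor_scale (a * b) x.
Proof.
elim/tensor_ind: x => s; rewrite !tensor_scaleE; congr tensor_class.
by rewrite /scale_terms -map_comp; apply: eq_map => -[u v] /=; rewrite scalerA.
Qed.

Lemma tensor_scaleDr : right_distributive tensor_scale +%R.
Proof.
move=> a; elim/tensor_ind=> s; elim/tensor_ind=> t.
rewrite -[_ + _]/(tensor_add _ _) tensor_addE !tensor_scaleE.
by rewrite -[RHS]/(tensor_add _ _) tensor_addE /scale_terms map_cat.
Qed.

HB.instance Definition _ := GRing.Zmodule_isLmodule.Build K tensor
  tensor_scaleA tensor_scale1 tensor_scaleDr
  (fun x a b => tensor_scaleDl x a b).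

Definition pure (u : U) (v : V) : tensor := tensor_class [:: (u, v)].

Lemma tensor_classE s : tensor_class s = \sum_(p <- s) pure p.1 p.2.
Proof.
elim: s => [|[u v] s IH]; first by rewrite big_nil.
by rewrite big_cons -IH -[RHS]/(tensor_add _ _) tensor_addE.
Qed.

Lemma sweedlerE t : t = \sum_(p <- sweedler t) pure p.1 p.2.
Proof. by rewrite -tensor_classE sweedlerK. Qed.

Lemma pure_is_bilinear : bilinear_for *:%R *:%R pure.
Proof.
split=> [v a u u'|u a v v'] /=.
  rewrite -[a *: pure u v]/(tensor_scale _ _) tensor_scaleE.
  rewrite -[RHS]/(tensor_add _ _) tensor_addE.
  by apply/tensor_classP; exact: tensor_rel_Dl.
rewrite -[a *: pure u v]/(tensor_scale _ _) tensor_scaleE.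
rewrite -[RHS]/(tensor_add _ _) tensor_addE.
apply/tensor_classP; apply: tensor_rel_trans (tensor_rel_Dr _ _ _) _.
rewrite -[X in rel X]/([:: _] ++ [:: _]).
apply: (@tensor_rel_cat _ _ _ _ [:: _] _ [:: _]); last exact: tensor_rel_refl.
exact/tensor_rel_sym/tensor_rel_Z.
Qed.

HB.instance Definition _ := bilinear_isBilinear.Build K U V tensor *:%R *:%R
  pure pure_is_bilinear.

(* The universal property: a Sweedler sum of a bilinear expression does not  *)
(* depend on the chosen representatives and is linear in the tensor.         *)

Section Lift.
Variables (W : lmodType K) (f : {bilinear U -> V -> W}).

Definition tensor_lift (t : tensor) : W := \sum_(p <- sweedler t) f p.1 p.2.

Lemma tensor_rel_lift s t :
  rel s t -> \sum_(p <- s) f p.1 p.2 = \sum_(p <- t) f p.1 p.2.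
Proof.
elim=> {s t} [s|s t _ IH|s t r _ -> _ ->|s s' t t' _ IH1 _ IH2|s t|v|u u' v
  |u v v'|b u v] //=.
- by rewrite !big_cat /= IH1 IH2.
- by rewrite !big_cat /= addrC.
- by rewrite big_cons !big_nil addr0 /= linear0l.
- by rewrite !big_cons !big_nil !addr0 /= linearDl.
- by rewrite !big_cons !big_nil !addr0 /= linearDr.
- by rewrite !big_cons !big_nil !addr0 /= linearZl_LR linearZr_LR.
Qed.

Lemma tensor_lift_class s :
  tensor_lift (tensor_class s) = \sum_(p <- s) f p.1 p.2.
Proof. exact/tensor_rel_lift/sweedler_class. Qed.

Lemma tensor_lift_pure u v : tensor_lift (pure u v) = f u v.
Proof. by rewrite tensor_lift_class big_seq1. Qed.

Lemma tensor_lift_is_linear : linear tensor_lift.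
Proof.
move=> a; elim/tensor_ind=> s; elim/tensor_ind=> t.
rewrite -[a *: _]/(tensor_scale _ _) tensor_scaleE.
rewrite -[_ + _]/(tensor_add _ _) tensor_addE !tensor_lift_class big_cat /=.
congr (_ + _); rewrite big_map scaler_sumr; apply: eq_bigr => p _ /=.
by rewrite linearZl_LR.
Qed.

HB.instance Definition _ := GRing.isLinear.Build K tensor W *:%R
  tensor_lift tensor_lift_is_linear.

Lemma tensor_lift_unique (g : {linear tensor -> W}) :
  (forall u v, g (pure u v) = f u v) -> g =1 tensor_lift.
Proof.
move=> gE t; rewrite [in LHS](sweedlerE t) linear_sum.
by apply: eq_bigr => p _; exact: gE.
Qed.

End Lift.
End TensorProduct.

Notation "U ⊗ V" := (tensor U V) : type_scope.
Notation "u ⊗ v" := (pure u v) : ring_scope.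

(* The operation (a ⊗ a') (b ⊗ b') = (f a b) ⊗ (g a' b') for bilinear f, g.  *)
Definition tensor_map2 (K : comNzRingType) (A A' B B' C C' : lmodType K)
    (f : A -> B -> C) (g : A' -> B' -> C') (x : A ⊗ A') (y : B ⊗ B') : C ⊗ C' :=
  \sum_(p <- sweedler x) \sum_(q <- sweedler y) f p.1 q.1 ⊗ g p.2 q.2.

(* Objects of the category H~(M_K) of modules with an automorphism.          *)
Record homModule (K : fieldType) := HomModule {
  hom_carrier :> lmodType K;
  twist : {linear hom_carrier -> hom_carrier};
  twistV : hom_carrier -> hom_carrier;
  twistK : cancel twist twistV;
  twistVK : cancel twistV twist
}.

Arguments twist {K} _.
Arguments twistV {K} _.

Record monHomHopf (K : fieldType) := MonHomHopf {
  hopf_module :> homModule K;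
  hmul : {bilinear hopf_module -> hopf_module -> hopf_module};
  hone : hopf_module;
  hcomul : {linear hopf_module -> (hopf_module ⊗ hopf_module)%type};
  hcounit : {scalar hopf_module};
  antipode : {linear hopf_module -> hopf_module};
  hmul_twist : forall a b, twist _ (hmul a b) = hmul (twist _ a) (twist _ b);
  hone_twist : twist _ hone = hone;
  hmul_assoc : forall a b c,
    hmul (twist _ a) (hmul b c) = hmul (hmul a b) (twist _ c);
  hmul1r : forall a, hmul a hone = twist _ a;
  hmul1l : forall a, hmul hone a = twist _ a;
  hcomul_twist : forall c, hcomul (twist _ c) =
    \sum_(p <- sweedler (hcomul c)) twist _ p.1 ⊗ twist _ p.2;
  hcounit_twist : forall c, hcounit (twist _ c) = hcounit c;
  hcomul_coassoc : forall c,
    \sum_(p <- sweedler (hcomul c)) twistV _ p.1 ⊗ hcomul p.2 =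
    \sum_(p <- sweedler (hcomul c)) \sum_(q <- sweedler (hcomul p.1))
      q.1 ⊗ (q.2 ⊗ twistV _ p.2);
  hcounit_r : forall c,
    \sum_(p <- sweedler (hcomul c)) hcounit p.2 *: p.1 = twistV _ c;
  hcounit_l : forall c,
    \sum_(p <- sweedler (hcomul c)) hcounit p.1 *: p.2 = twistV _ c;
  hcomul_mul : forall a b,
    hcomul (hmul a b) = tensor_map2 hmul hmul (hcomul a) (hcomul b);
  hcomul_one : hcomul hone = hone ⊗ hone;
  hcounit_mul : forall a b, hcounit (hmul a b) = hcounit a * hcounit b;
  hcounit_one : hcounit hone = 1;
  antipode_twist : forall h, antipode (twist _ h) = twist _ (antipode h);
  antipode_l : forall h,
    \sum_(p <- sweedler (hcomul h)) hmul (antipode p.1) p.2 = hcounit h *: hone;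
  antipode_r : forall h,
    \sum_(p <- sweedler (hcomul h)) hmul p.1 (antipode p.2) = hcounit h *: hone
}.

Arguments hmul {K} _.
Arguments hone {K} _.
Arguments hcomul {K} _.
Arguments hcounit {K} _.
Arguments antipode {K} _.

Record homBimodule (K : fieldType) (H : monHomHopf K) := HomBimodule {
  bimod_module :> homModule K;
  lact : {bilinear H -> bimod_module -> bimod_module};
  ract : {bilinear bimod_module -> H -> bimod_module};
  lact_twist : forall h m, twist _ (lact h m) = lact (twist _ h) (twist _ m);
  ract_twist : forall m h, twist _ (ract m h) = ract (twist _ m) (twist _ h);
  lact_assoc : forall g h m,
    lact (twist _ g) (lact h m) = lact (hmul H g h) (twist _ m);
  lact1 : forall m, lact (hone H) m = twist _ m;
  ract_assoc : forall m g h,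
    ract (ract m g) (twist _ h) = ract (twist _ m) (hmul H g h);
  ract1 : forall m, ract m (hone H) = twist _ m;
  lract_assoc : forall g m h,
    ract (lact g m) (twist _ h) = lact (twist _ g) (ract m h)
}.

Arguments lact {K H} _.
Arguments ract {K H} _.

Record leftCovBimodule (K : fieldType) (H : monHomHopf K) := LeftCovBimodule {
  covbimod_bimodule :> homBimodule H;
  coact : {linear covbimod_bimodule -> (H ⊗ covbimod_bimodule)%type};
  coact_twist : forall m, coact (twist _ m) =
    \sum_(p <- sweedler (coact m)) twist _ p.1 ⊗ twist _ p.2;
  coact_coassoc : forall m,
    \sum_(p <- sweedler (coact m)) hcomul H p.1 ⊗ twistV _ p.2 =
    \sum_(p <- sweedler (coact m)) \sum_(q <- sweedler (coact p.2))
      (twistV _ p.1 ⊗ q.1) ⊗ q.2;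
  coact_counit : forall m,
    \sum_(p <- sweedler (coact m)) hcounit H p.1 *: p.2 = twistV _ m;
  coact_covariant : forall h m g,
    coact (ract _ (lact _ h m) (twist _ g)) =
    tensor_map2 (hmul H) (lact covbimod_bimodule) (hcomul H (twist _ h))
      (tensor_map2 (hmul H) (ract covbimod_bimodule)
         (coact m) (hcomul H g))
}.

Arguments coact {K H} _.

Local Open Scope classical_set_scope.

Definition coinvariant (K : fieldType) (H : monHomHopf K)
    (M : leftCovBimodule H) : set M :=
  [set m : M | coact M m = hone H ⊗ twistV _ m].

Arguments coinvariant {K H} M _.

(* \sum_(i \in A) is the sum over the support when the support is finite, and *)
(* 0 otherwise, so finiteness of the support is always required separately.  *)
Definition finsupp_fun (I : choiceType) (A : zmodType) (c : I -> A) : Prop :=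
  finite_set [set i | c i != 0].

Definition linear_basis (K : fieldType) (V : lmodType K) (W : set V)
    (I : choiceType) (e : I -> V) : Prop :=
  [/\ forall i, W (e i),
      forall c : I -> K, finsupp_fun c ->
        \sum_(i \in [set: I]) c i *: e i = 0 -> forall i, c i = 0
    & forall v, W v -> exists2 c : I -> K,
        finsupp_fun c & v = \sum_(i \in [set: I]) c i *: e i].

Definition free_left_basis (K : fieldType) (H : monHomHopf K)
    (M : homBimodule H) (I : choiceType) (e : I -> M) : Prop :=
  forall m : M, exists! h : I -> H,
    finsupp_fun h /\ m = \sum_(i \in [set: I]) lact M (h i) (e i).

Definition free_right_basis (K : fieldType) (H : monHomHopf K)
    (M : homBimodule H) (I : choiceType) (e : I -> M) : Prop :=
  forall m : M, exists! h : I -> H,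
    finsupp_fun h /\ m = \sum_(i \in [set: I]) ract M (e i) (h i).

(* f • h = alpha^2(h_1) f(alpha(h_2)).                                       *)
Definition bullet (K : fieldType) (H : monHomHopf K) (f : H -> K) (h : H) : H :=
  \sum_(p <- sweedler (hcomul H h)) f (twist H p.2) *: twist H (twist H p.1).

Definition pointwise_finite (K : fieldType) (H : monHomHopf K) (I : choiceType)
    (f : I -> I -> {scalar H}) : Prop :=
  forall i h, finite_set [set j | f i j h != 0].

(* Main.v *)
(* Untwisting reduces everything to an ordinary Hopf bimodule: with product   *)
(* alpha^-1(ab), coproduct Delta o alpha, actions mu^-1(hm) and mu^-1(mh) and *)
(* coaction rho o mu, H becomes a Hopf algebra and M a left-covariant         *)
(* bimodule, alpha and mu being automorphisms of these structures, and the    *)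
(* coinvariants are the elements with rho(mu(m)) = 1 ⊗ m. The map             *)
(*   P m = S(m_(-1)) m_(0)                                                    *)
(* projects M onto the coinvariants, with m = m_(-1) P(m_(0)),                *)
(* P(hm) = eps(h) P(m) and P(mh) = P(P(m)h). Hence m |-> m_(-1) c_i(P(m_(0))),*)
(* c_i being the coordinates on the coinvariants, are the coordinates of the  *)
(* free left module, and f^i_j(h) = c_j(P(m_i h)). For coinvariant v one gets *)
(*   v h = h_1 P(v h_2),   h v = P(v S^-1(h_2)) h_1,                          *)
(* and the latter shows that m |-> m_(-2) c_i(P(m_(0) S^-1(m_(-1)))) are the  *)
(* coordinates of the free right module.                                      *)

Require Import Defs.
From HB Require Import structures.
From mathcomp Require Import all_boot all_order all_algebra.
From mathcomp Require Import finmap.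
From mathcomp Require Import boolp classical_sets functions cardinality fsbigop.

Set Implicit Arguments.
Unset Strict Implicit.
Unset Printing Implicit Defensive.
Import GRing.Theory.
Local Open Scope classical_set_scope.
Local Open Scope ring_scope.

(** In untwisted notation ([mul], [la], [ra], [cop], [coac]) the claim becomes the structure theorem
    for left-covariant bimodules over an ordinary Hopf algebra; the twists only reappear when the
    given actions and [bullet] are translated.

    Everything rests on the projection P = [coproj], P(m) = S(m_(-1)) m_(0). It lands in the
    coinvariants ([coproj_coinvariant]) and fixes them ([coproj_id]), and m = m_(-1) P(m_(0))
    ([coprojE]), so the coinvariants generate M on the left. Since P(hm) = ε(h) P(m) ([coproj_la]),
    the map m |-> m_(-1) c_i(P(m_(0))) reads off the i-th left coefficient, and freeness follows
    from [unique_expansion].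

    The identity P(mh) = P(P(m)h) ([coproj_ra]) makes (v, h) |-> P(vh) a right action of H on the
    coinvariants. The functionals f are the matrix of this action, taken with the original [ract];
    hence the twists in their multiplication rule. The commutation formula is vh = h_1 P(v h_2)
    ([ra_coinvariant]). With the inverse antipode it can be solved for the left action, hv = P(v
    S^-1(h_2)) h_1 ([la_coinvariant]). So the coinvariants also generate M on the right, and right
    coefficients are read off by m |-> m_(-2) c_i(P(m_(0) S^-1(m_(-1)))). *)

Section Multilinear.
Variable K : fieldType.
Implicit Types U V W X : lmodType K.

(** * Multilinearity predicates and Sweedler sums *)

Definition lin U V (f : U -> V) : Prop :=
  forall a x y, f (a *: x + y) = a *: f x + f y.

Definition linform U (f : U -> K) : Prop :=
  forall a x y, f (a *: x + y) = a * f x + f y.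

Definition bilin U V W (f : U -> V -> W) : Prop :=
  (forall v, lin (f^~ v)) /\ (forall u, lin (f u)).

Definition trilin U V W X (f : U -> V -> W -> X) : Prop :=
  (forall v w, lin (fun u => f u v w)) /\ (forall u, bilin (f u)).

Lemma lin_sumE U V (g : U -> V) (T : Type) (s : seq T) (F : T -> U) :
  lin g -> g (\sum_(x <- s) F x) = \sum_(x <- s) g (F x).
Proof.
move=> gl; pose g' : {linear U -> V} := HB.pack g (GRing.isLinear.Build _ _ _ _ g gl).
exact: (linear_sum g').
Qed.

Lemma linZ U V (f : U -> V) a x : lin f -> f (a *: x) = a *: f x.
Proof.
move=> fl; have f0 : f 0 = 0.
  by apply: (addrI (f 0)); have := fl 1 0 0; rewrite !scale1r !addr0 => /esym.
by rewrite -[a *: x]addr0 fl f0 addr0.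
Qed.

Lemma linP U V (f : {linear U -> V}) : lin f.
Proof. by move=> a x y; rewrite linearP. Qed.

Lemma linformP U (f : {scalar U}) : linform f.
Proof. by move=> a x y; rewrite linearP. Qed.

Lemma lin_id U : lin (fun x : U => x).
Proof. by []. Qed.

Lemma lin_comp U V W (g : V -> W) (F : U -> V) :
  lin g -> lin F -> lin (fun x => g (F x)).
Proof. by move=> gl Fl a x y; rewrite Fl gl. Qed.

Lemma lin_bigsum U V (T : Type) (s : seq T) (F : T -> U -> V) :
  (forall p, lin (F p)) -> lin (fun x => \sum_(p <- s) F p x).
Proof.
move=> Fl a x y; rewrite scaler_sumr -big_split /=.
by apply: eq_bigr => p _; exact: Fl.
Qed.

Lemma lin_scale U V (c : K) (F : U -> V) :
  lin F -> lin (fun x => c *: F x).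
Proof. by move=> Fl a x y; rewrite Fl scalerDr !scalerA mulrC. Qed.

Lemma lin_scalel U V (c : U -> K) (v : V) :
  linform c -> lin (fun x => c x *: v).
Proof. by move=> cl a x y; rewrite cl scalerDl scalerA. Qed.

Lemma linform_comp U V (g : V -> K) (F : U -> V) :
  linform g -> lin F -> linform (fun x => g (F x)).
Proof. by move=> gl Fl a x y; rewrite Fl gl. Qed.

Lemma bilinP U V W (f : {bilinear U -> V -> W}) : bilin f.
Proof. by split=> [v|u] a x y; rewrite ?linearPl ?linearPr. Qed.

Lemma lin_bilinl U V W X (f : U -> V -> W) (F : X -> U) v :
  bilin f -> lin F -> lin (fun x => f (F x) v).
Proof. by move=> fl; exact: (lin_comp (fl.1 v)). Qed.

(** [sweedler] picks an arbitrary representative, so such a sum is meaningful only for bilinear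
    summands, where it is [tensor_lift]. This is the source of the multilinearity side conditions on
    all Sweedler manipulations below. *)
Lemma lin_sweedler U V W X (f : U -> V -> W) (F : X -> (U ⊗ V)%type) :
  bilin f -> lin F ->
  lin (fun x => \sum_(p <- sweedler (F x)) f p.1 p.2).
Proof.
move=> fl; apply: (@lin_comp _ _ _ (fun t => \sum_(p <- sweedler t) f p.1 p.2)).
pose f' : {bilinear U -> V -> W} :=
  HB.pack f (bilinear_isBilinear.Build K U V W *:%R *:%R f (fl.1, fl.2)).
exact: (tensor_lift_is_linear f').
Qed.

Lemma sweedler_pure U V W (f : U -> V -> W) u v : bilin f ->
  \sum_(p <- sweedler (u ⊗ v)) f p.1 p.2 = f u v.
Proof.
move=> fl.
pose f' : {bilinear U -> V -> W} :=
  HB.pack f (bilinear_isBilinear.Build K U V W *:%R *:%R f (fl.1, fl.2)).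
exact: (tensor_lift_pure f').
Qed.

Lemma sweedler_sum_pure U V W (f : U -> V -> W) (T : Type) (s : seq T) u v :
  bilin f ->
  \sum_(p <- sweedler (\sum_(x <- s) u x ⊗ v x)) f p.1 p.2 =
  \sum_(x <- s) f (u x) (v x).
Proof.
move=> fl; rewrite (lin_sumE _ _ (lin_sweedler fl (@lin_id _))).
by apply: eq_bigr => x _; exact: sweedler_pure.
Qed.

End Multilinear.

(** * Linearity of the inverse twist and automation of multilinearity *)

Section HomModules.
Variable K : fieldType.

Lemma twistV_is_linear (M : homModule K) : lin (twistV M).
Proof.
by move=> a x y; apply: (can_inj (@twistK _ M)); rewrite linearP !twistVK.
Qed.

HB.instance Definition _ (M : homModule K) :=
  GRing.isLinear.Build K M M *:%R (twistV M) (@twistV_is_linear M).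

Lemma twistV_lin (M : homModule K) : lin (twistV M).
Proof. exact: linP. Qed.

End HomModules.

Create HintDb multilinear.
#[global] Hint Resolve linP linformP bilinP twistV_lin : multilinear.

(** Recursion on the shape of the term, with one slot varying at a time. A sum over a fixed sequence
    is linear termwise; a sum over [sweedler] of a varying tensor needs the summand to be bilinear
    in the two legs. *)
Ltac multilinear :=
  cbn beta;
  match goal with
  | |- _ => solve [auto with multilinear]
  | |- trilin (fun _ => _) => split; [move=> ? ? | move=> ?]; multilinear
  | |- bilin (fun _ => _) => split; move=> ?; multilinear
  | |- bilin (?f ?u) => refine (proj2 (_ : trilin f) u); multilinear
  | |- lin (?f ?u) => refine (proj2 (_ : bilin f) u); multilinear
  | |- lin (fun x => x) => exact: lin_id
  | |- lin (fun x => \big[_/_]_(p <- ?s) (@?E x p)) =>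
    refine (@lin_bigsum _ _ _ _ s (fun p x => E x p) _);
    move=> ?; multilinear
  | |- lin (fun x => \big[_/_]_(p <- sweedler (@?F x)) (@?E p)) =>
    refine (@lin_sweedler _ _ _ _ _ (fun u v => E (u, v)) F _ _);
    cbn [fst snd]; multilinear
  | |- lin (fun x => ?c *: (@?F x)) =>
    refine (@lin_scale _ _ _ c F _); multilinear
  | |- lin (fun x => (@?c x) *: ?v) =>
    refine (@lin_scalel _ _ _ c v _); multilinear
  | |- linform (fun x => ?g (@?F x)) =>
    refine (@linform_comp _ _ _ g F _ _); multilinear
  | |- lin (fun x => ?g (@?F x)) =>
    refine (@lin_comp _ _ _ _ g F _ _); multilinear
  | |- lin (fun x => ?f (@?F x) ?v) =>
    refine (@lin_bilinl _ _ _ _ _ f F v _ _); multilinear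
  | |- lin (fun x => ?f (@?F x) ?v ?w) =>
    refine (lin_comp (F := F) (proj1 (_ : trilin f) v w) _); multilinear
  | |- lin (fun x => ?f ?u (@?F x) ?w) =>
    refine (lin_bilinl (F := F) w (proj2 (_ : trilin f) u) _); multilinear
  end.

Lemma sweedler_map2 (K : fieldType) (A A' B B' C C' W : lmodType K)
    (F : C -> C' -> W) (f : A -> B -> C) (g : A' -> B' -> C') x y :
  bilin F ->
  \sum_(p <- sweedler (tensor_map2 f g x y)) F p.1 p.2 =
  \sum_(p <- sweedler x) \sum_(q <- sweedler y) F (f p.1 q.1) (g p.2 q.2).
Proof.
move=> Fl; rewrite /tensor_map2.
rewrite (lin_sumE _ _ (lin_sweedler Fl (@lin_id _ _))).
by apply: eq_bigr => p _; rewrite (sweedler_sum_pure _ (fun q => _) (fun q => _) Fl).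
Qed.

(** * The underlying ordinary Hopf algebra *)

Section Untwist.
Variables (K : fieldType) (H : monHomHopf K).
Local Notation α := (twist H).
Local Notation α' := (twistV H).
Local Notation S := (antipode H).
Local Notation ε := (hcounit H).
Implicit Types U W : lmodType K.

Definition mul (a b : H) : H := α' (hmul H a b).

Lemma mul_is_bilinear : bilinear_for *:%R *:%R mul.
Proof.
by split=> [b c x y|b c x y]; rewrite /mul ?linearPl ?linearPr linearP.
Qed.

HB.instance Definition _ :=
  bilinear_isBilinear.Build K H H H *:%R *:%R mul mul_is_bilinear.

Lemma mul_bilin : bilin mul.
Proof. exact: bilinP. Qed.

Local Hint Resolve mul_bilin : multilinear.

Lemma hmulE a b : hmul H a b = α (mul a b).
Proof. by rewrite twistVK. Qed.

Lemma twist_mul a b : α (mul a b) = mul (α a) (α b).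
Proof. by rewrite -hmulE /mul -hmul_twist twistK. Qed.

Lemma mulA : associative mul.
Proof.
move=> a b c; do 2!apply: (can_inj (@twistK _ H)).
by rewrite -(hmulE a) hmul_twist -hmulE hmul_assoc !hmulE !twist_mul.
Qed.

Lemma mul1l : left_id (hone H) mul.
Proof. by move=> a; rewrite /mul hmul1l twistK. Qed.

Lemma mul1r : right_id (hone H) mul.
Proof. by move=> a; rewrite /mul hmul1r twistK. Qed.

Lemma counit_mul a b : ε (mul a b) = ε a * ε b.
Proof. by rewrite -hcounit_mul -[in RHS](twistVK (hmul H a b)) hcounit_twist. Qed.

Local Notation cop h := (sweedler (hcomul H (α h))).

Lemma copE W (f : H -> H -> W) h : bilin f ->
  \sum_(p <- cop h) f p.1 p.2 =
  \sum_(p <- sweedler (hcomul H h)) f (α p.1) (α p.2).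
Proof.
by move=> fl; rewrite hcomul_twist (sweedler_sum_pure _ (fun p => _) (fun p => _) fl).
Qed.

Lemma cop_twist W (f : H -> H -> W) h : bilin f ->
  \sum_(p <- cop (α h)) f p.1 p.2 = \sum_(p <- cop h) f (α p.1) (α p.2).
Proof. by move=> fl; rewrite copE. Qed.

Lemma cop_coassoc W (T : H -> H -> H -> W) h : trilin T ->
  \sum_(p <- cop h) \sum_(q <- cop p.1) T q.1 q.2 p.2 =
  \sum_(p <- cop h) \sum_(q <- cop p.2) T p.1 q.1 q.2.
Proof.
move=> Tl.
(* Twisting every leg cancels the inverse twists in [hcomul_coassoc], used at [α h], and turns the
   inner coproducts into untwisted ones. *)
pose F x t := \sum_(q <- sweedler t) T (α x) (α q.1) (α q.2).
have Fl : bilin F by rewrite /F; multilinear.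
have FP x y z : F x (y ⊗ z) = T (α x) (α y) (α z).
  rewrite /F (sweedler_pure (f := fun y z => T (α x) (α y) (α z))) //.
  by multilinear.
have := congr1 (fun t => \sum_(p <- sweedler t) F p.1 p.2)
  (hcomul_coassoc (α h)).
rewrite /= (sweedler_sum_pure _ (fun p => α' p.1) (fun p => _) Fl).
rewrite (lin_sumE _ _ (lin_sweedler Fl (@lin_id _ _))).
under [in X in _ = X]eq_bigr => p _.
  rewrite (sweedler_sum_pure _ (fun q => q.1) (fun q => _) Fl).
  under eq_bigr => q _ do rewrite FP twistVK.
  over.
under [in X in X = _]eq_bigr => p _ do rewrite /F twistVK.
move=> E.
transitivity (\sum_(p <- cop h) \sum_(q <- sweedler (hcomul H p.1))
    T (α q.1) (α q.2) p.2).
  apply: eq_bigr => p _.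
  by apply: (copE (f := fun x y => T x y p.2)); multilinear.
rewrite -E; apply: eq_bigr => p _; apply/esym.
by apply: (copE (f := fun x y => T p.1 x y)); multilinear.
Qed.

Lemma cop_counit_l h W (g : H -> W) : lin g ->
  \sum_(p <- cop h) ε p.1 *: g p.2 = g h.
Proof.
move=> gl; rewrite -[in RHS](twistK h) -(hcounit_l (α h)) (lin_sumE _ _ gl).
by apply: eq_bigr => p _; rewrite (linZ _ _ gl).
Qed.

Lemma cop_counit_r h W (g : H -> W) : lin g ->
  \sum_(p <- cop h) ε p.2 *: g p.1 = g h.
Proof.
move=> gl; rewrite -[in RHS](twistK h) -(hcounit_r (α h)) (lin_sumE _ _ gl).
by apply: eq_bigr => p _; rewrite (linZ _ _ gl).
Qed.

Lemma cop_mul W (f : H -> H -> W) a b : bilin f ->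
  \sum_(p <- cop (mul a b)) f p.1 p.2 =
  \sum_(p <- cop a) \sum_(q <- cop b) f (mul p.1 q.1) (mul p.2 q.2).
Proof.
move=> fl; rewrite -hmulE hcomul_mul sweedler_map2 //.
transitivity (\sum_(p <- sweedler (hcomul H a))
    \sum_(q <- sweedler (hcomul H b))
      f (mul (α p.1) (α q.1)) (mul (α p.2) (α q.2))).
  apply: eq_bigr => p _.
  by apply: eq_bigr => q _; rewrite !hmulE !twist_mul.
transitivity (\sum_(p <- sweedler (hcomul H a)) \sum_(q <- cop b)
      f (mul (α p.1) q.1) (mul (α p.2) q.2)).
  apply: eq_bigr => p _; apply/esym.
  by apply: (copE (f := fun x y => f (mul (α p.1) x) (mul (α p.2) y)));
    multilinear.
apply/esym; apply: (copE (f := fun x y =>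
    \sum_(q <- cop b) f (mul x q.1) (mul y q.2))).
by multilinear.
Qed.

Lemma cop_one W (f : H -> H -> W) : bilin f ->
  \sum_(p <- cop (hone H)) f p.1 p.2 = f (hone H) (hone H).
Proof. by move=> fl; rewrite hone_twist hcomul_one sweedler_pure. Qed.

Lemma antipode_l_untwisted h :
  \sum_(p <- cop h) mul (S p.1) p.2 = ε h *: hone H.
Proof.
rewrite /mul -linear_sum antipode_l hcounit_twist linearZ /=.
by rewrite -[in LHS]hone_twist twistK.
Qed.

Lemma antipode_r_untwisted h :
  \sum_(p <- cop h) mul p.1 (S p.2) = ε h *: hone H.
Proof.
rewrite /mul -linear_sum antipode_r hcounit_twist linearZ /=.
by rewrite -[in LHS]hone_twist twistK.
Qed.

Lemma antipode_one : S (hone H) = hone H.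
Proof.
have := antipode_l_untwisted (hone H).
rewrite (cop_one (f := fun x y => mul (S x) y)); last by multilinear.
by rewrite hcounit_one scale1r mul1r.
Qed.

(** Half of antimultiplicativity: S(a_1 b) a_2 = S(a_1 b_1) a_2 b_2 S(b_3), and S(a_1 b_1) a_2 b_2
    collapses because the coproduct is multiplicative. *)
Lemma antipode_mull a b :
  \sum_(p <- cop a) mul (S (mul p.1 b)) p.2 = ε a *: S b.
Proof.
pose T x y z := \sum_(p <- cop a) mul (mul (S (mul p.1 x)) (mul p.2 y)) (S z).
have Tl : trilin T by rewrite /T; multilinear.
transitivity (\sum_(q <- cop b) \sum_(r <- cop q.2) T q.1 r.1 r.2).
  transitivity (\sum_(q <- cop b)
      ε q.2 *: \sum_(p <- cop a) mul (S (mul p.1 q.1)) p.2).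
    apply/esym; apply: (cop_counit_r _ (g := fun x =>
      \sum_(p <- cop a) mul (S (mul p.1 x)) p.2)).
    by multilinear.
  apply: eq_bigr => q _; rewrite /T exchange_big scaler_sumr /=.
  apply: eq_bigr => p _; under eq_bigr => r _ do rewrite -!mulA.
  by rewrite -!linear_sumr /= antipode_r_untwisted !linearZr_LR /= mul1r.
rewrite -(cop_coassoc _ Tl).
transitivity (\sum_(q <- cop b) ε q.1 *: (ε a *: S q.2)); last first.
  by apply: (cop_counit_l _ (g := fun x => ε a *: S x)); multilinear.
apply: eq_bigr => q _; rewrite /T exchange_big /=.
under eq_bigr => p _ do rewrite -linear_sumlz.
rewrite -linear_sumlz /=.
rewrite -(cop_mul (f := fun x y => mul (S x) y)); last by multilinear.
by rewrite antipode_l_untwisted counit_mul linearZl_LR /= mul1l scalerA mulrC.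
Qed.

(** S(ab) = S(a_1 b) a_2 S(a_3), and the first two factors collapse to S(b) by [antipode_mull]. *)
Lemma antipode_mul a b : S (mul a b) = mul (S b) (S a).
Proof.
pose T x y z := mul (mul (S (mul x b)) y) (S z).
have Tl : trilin T by rewrite /T; multilinear.
transitivity (\sum_(p <- cop a) \sum_(q <- cop p.2) T p.1 q.1 q.2).
  rewrite -(@cop_counit_r a _ (fun x => S (mul x b))); last by multilinear.
  apply: eq_bigr => p _; under eq_bigr => q _ do rewrite /T -mulA.
  by rewrite -linear_sumr /= antipode_r_untwisted linearZr_LR /= mul1r.
rewrite -(cop_coassoc _ Tl).
rewrite -[RHS](@cop_counit_l a _ (fun x => mul (S b) (S x)));
  last by multilinear.
apply: eq_bigr => p _.
by rewrite /T -linear_sumlz /= antipode_mull linearZl_LR.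
Qed.

Lemma antipode_twistV h : S (α' h) = α' (S h).
Proof. by apply: (can_inj (@twistK _ H)); rewrite -antipode_twist !twistVK. Qed.

Section InverseAntipode.
Variable SV : {linear H -> H}.
Hypotheses (SK : cancel S SV) (SVK : cancel SV S).

(** Applying the injective antimultiplicative S turns this into the antipode axiom; the swap of the
    two legs compensates the reversal of the product. *)
Lemma antipodeV_l h : \sum_(p <- cop h) mul (SV p.2) p.1 = ε h *: hone H.
Proof.
apply: (can_inj SK); rewrite linear_sum linearZ /= antipode_one.
rewrite -antipode_l_untwisted; apply: eq_bigr => p _.
by rewrite antipode_mul SVK.
Qed.

Lemma antipodeV_r h : \sum_(p <- cop h) mul p.2 (SV p.1) = ε h *: hone H.
Proof.
apply: (can_inj SK); rewrite linear_sum linearZ /= antipode_one.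
rewrite -antipode_r_untwisted; apply: eq_bigr => p _.
by rewrite antipode_mul SVK.
Qed.

Lemma antipodeV_twistV h : SV (α' h) = α' (SV h).
Proof. by apply: (can_inj SK); rewrite SVK antipode_twistV SVK. Qed.

End InverseAntipode.

(** In the untwisted coproduct the powers of α in [bullet] cancel, except for one inverse twist
    inside the functional. *)
Lemma bulletE (g : H -> K) h : linform g ->
  bullet g (α' h) = \sum_(p <- cop h) g (α' p.2) *: p.1.
Proof.
move=> gl; rewrite /bullet -[in RHS](twistVK h).
pose f (x y : H) := g (α' y) *: x.
have fl : bilin f by rewrite /f; multilinear.
rewrite (cop_twist _ fl) /f.
rewrite (copE (f := fun x y => g (α' (α y)) *: α x)); last by multilinear.
by apply: eq_bigr => p _; rewrite !twistK.
Qed.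

End Untwist.

(** * The underlying ordinary left-covariant bimodule *)

Section UntwistBimodule.
Variables (K : fieldType) (H : monHomHopf K) (M : leftCovBimodule H).
Local Notation α := (twist H).
Local Notation α' := (twistV H).
Local Notation μ := (twist M).
Local Notation μ' := (twistV M).
Local Notation S := (antipode H).
Local Notation ε := (hcounit H).
Local Notation cop h := (sweedler (hcomul H (α h))).
Local Notation coac m := (sweedler (coact M (μ m))).
Local Notation mul := (@mul K H).
Implicit Types U W : lmodType K.
Implicit Types (m v : M).

Definition la (h : H) (m : M) : M := μ' (lact M h m).
Definition ra (m : M) (h : H) : M := μ' (ract M m h).

Lemma la_is_bilinear : bilinear_for *:%R *:%R la.
Proof.
by split=> [b c x y|b c x y]; rewrite /la ?linearPl ?linearPr linearP.
Qed.

HB.instance Definition _ :=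
  bilinear_isBilinear.Build K H M M *:%R *:%R la la_is_bilinear.

Lemma ra_is_bilinear : bilinear_for *:%R *:%R ra.
Proof.
by split=> [b c x y|b c x y]; rewrite /ra ?linearPl ?linearPr linearP.
Qed.

HB.instance Definition _ :=
  bilinear_isBilinear.Build K M H M *:%R *:%R ra ra_is_bilinear.

Lemma la_bilin : bilin la. Proof. exact: bilinP. Qed.
Lemma ra_bilin : bilin ra. Proof. exact: bilinP. Qed.
Local Hint Resolve la_bilin ra_bilin mul_bilin : multilinear.

Lemma lactE h m : lact M h m = μ (la h m).
Proof. by rewrite twistVK. Qed.

Lemma ractE m h : ract M m h = μ (ra m h).
Proof. by rewrite twistVK. Qed.

Lemma twist_la h m : μ (la h m) = la (α h) (μ m).
Proof. by rewrite -lactE /la -lact_twist twistK. Qed.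

Lemma twist_ra m h : μ (ra m h) = ra (μ m) (α h).
Proof. by rewrite -ractE /ra -ract_twist twistK. Qed.

Lemma la_mul g h m : la (mul g h) m = la g (la h m).
Proof.
do 2!apply: (can_inj (@twistK _ M)); rewrite -!lactE !lact_twist.
by rewrite -lactE lact_assoc hmulE.
Qed.

Lemma ra_mul m g h : ra m (mul g h) = ra (ra m g) h.
Proof.
do 2!apply: (can_inj (@twistK _ M)); rewrite -!ractE !ract_twist.
by rewrite -ractE ract_assoc hmulE.
Qed.

Lemma la_ra g m h : ra (la g m) h = la g (ra m h).
Proof.
do 2!apply: (can_inj (@twistK _ M)); rewrite -ractE -lactE ract_twist lact_twist.
by rewrite -lactE -ractE lract_assoc.
Qed.

Lemma la1 m : la (hone H) m = m.
Proof. by rewrite /la lact1 twistK. Qed.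

Lemma ra1 m : ra m (hone H) = m.
Proof. by rewrite /ra ract1 twistK. Qed.

Lemma coacE W (f : H -> M -> W) m : bilin f ->
  \sum_(p <- coac m) f p.1 p.2 =
  \sum_(p <- sweedler (coact M m)) f (α p.1) (μ p.2).
Proof.
by move=> fl; rewrite coact_twist (sweedler_sum_pure _ (fun p => _) (fun p => _) fl).
Qed.

Lemma coac_twist W (f : H -> M -> W) m : bilin f ->
  \sum_(p <- coac (μ m)) f p.1 p.2 = \sum_(p <- coac m) f (α p.1) (μ p.2).
Proof. by move=> fl; rewrite coacE. Qed.

Lemma coac_coassoc W (T : H -> H -> M -> W) m : trilin T ->
  \sum_(p <- coac m) \sum_(q <- cop p.1) T q.1 q.2 p.2 =
  \sum_(p <- coac m) \sum_(q <- coac p.2) T p.1 q.1 q.2.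
Proof.
move=> Tl.
pose F t z := \sum_(q <- sweedler t) T (α q.1) (α q.2) (μ z).
have Fl : bilin F by rewrite /F; multilinear.
have FP x y z : F (x ⊗ y) z = T (α x) (α y) (μ z).
  rewrite /F (sweedler_pure (f := fun x y => T (α x) (α y) (μ z))) //.
  by multilinear.
have := congr1 (fun t => \sum_(p <- sweedler t) F p.1 p.2)
  (coact_coassoc (μ m)).
rewrite /= (sweedler_sum_pure _ (fun p => hcomul H p.1) (fun p => _) Fl).
rewrite (lin_sumE _ _ (lin_sweedler Fl (@lin_id _ _))).
under [in X in _ = X]eq_bigr => p _.
  rewrite (sweedler_sum_pure _ (fun q => _ ⊗ q.1) (fun q => q.2) Fl).
  under eq_bigr => q _ do rewrite FP twistVK.
  over.
under [in X in X = _]eq_bigr => p _ do rewrite /F twistVK.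
move=> E.
transitivity (\sum_(p <- coac m) \sum_(q <- sweedler (hcomul H p.1))
    T (α q.1) (α q.2) p.2).
  apply: eq_bigr => p _.
  by apply: (copE (f := fun x y => T x y p.2)); multilinear.
rewrite E; apply: eq_bigr => p _; apply/esym.
by apply: (coacE (f := fun x y => T p.1 x y)); multilinear.
Qed.

Lemma coac_counit m W (g : M -> W) : lin g ->
  \sum_(p <- coac m) ε p.1 *: g p.2 = g m.
Proof.
move=> gl; rewrite -[in RHS](twistK m) -(coact_counit (μ m)) (lin_sumE _ _ gl).
by apply: eq_bigr => p _; rewrite (linZ _ _ gl).
Qed.

Lemma coacV W (f : H -> M -> W) m : bilin f ->
  \sum_(p <- coac m) f p.1 p.2 =
  \sum_(p <- sweedler (coact M (μ (μ m)))) f (α' p.1) (μ' p.2).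
Proof.
move=> fl; rewrite (coac_twist (f := fun x y => f (α' x) (μ' y))).
  by under [RHS]eq_bigr => p _ do rewrite !twistK.
by multilinear.
Qed.

Lemma coac_la W (f : H -> M -> W) h m : bilin f ->
  \sum_(p <- coac (la h m)) f p.1 p.2 =
  \sum_(p <- cop h) \sum_(q <- coac m) f (mul p.1 q.1) (la p.2 q.2).
Proof.
(* The remaining twist of M is written as the right action of 1 = α(1), which is covariance with g =
   1. *)
move=> fl; rewrite coacV // -lactE -ract1 -hone_twist coact_covariant.
rewrite (sweedler_map2 (F := fun x y => f (α' x) (μ' y))); last by multilinear.
apply: eq_bigr => p _ /=.
rewrite (sweedler_map2 (F := fun x y =>
  f (α' (hmul H p.1 x)) (μ' (lact M p.2 y)))); last by multilinear.
rewrite hcomul_one (coacE (f := fun x y => f (mul p.1 x) (la p.2 y))); last first.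
  by multilinear.
apply: eq_bigr => q _.
rewrite (sweedler_pure (f := fun x y => f (α' (hmul H p.1 (hmul H q.1 x)))
  (μ' (lact M p.2 (ract M q.2 y))))); last by multilinear.
by rewrite hmul1r ract1.
Qed.

Lemma coac_ra W (f : H -> M -> W) m h : bilin f ->
  \sum_(p <- coac (ra m h)) f p.1 p.2 =
  \sum_(p <- coac m) \sum_(q <- cop h) f (mul p.1 q.1) (ra p.2 q.2).
Proof.
(* Here the twist of M is the left action of 1, so covariance applies with h = 1. *)
move=> fl; rewrite coacV // -ractE ract_twist -[in LHS]lact1 coact_covariant.
rewrite (sweedler_map2 (F := fun x y => f (α' x) (μ' y))); last by multilinear.
rewrite hone_twist hcomul_one.
rewrite (sweedler_pure (f := fun x y => \sum_(q <- sweedler _)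
  f (α' (hmul H x q.1)) (μ' (lact M y q.2)))); last by multilinear.
rewrite (sweedler_map2 (F := fun x y =>
  f (α' (hmul H (hone H) x)) (μ' (lact M (hone H) y)))); last by multilinear.
rewrite [RHS](coacE (f := fun x y =>
  \sum_(q <- cop h) f (mul x q.1) (ra y q.2))); last first.
  by multilinear.
apply: eq_bigr => p _.
rewrite [RHS](copE (f := fun x y => f (mul (α p.1) x) (ra (μ p.2) y)));
  last by multilinear.
by apply: eq_bigr => q _; rewrite hmul1l lact1 !twistK hmulE twist_mul ractE twist_ra.
Qed.

Lemma coac_coinvariant W (f : H -> M -> W) v : coinvariant M v -> bilin f ->
  \sum_(p <- coac v) f p.1 p.2 = f (hone H) v.
Proof.
move=> vc fl; rewrite coacE // vc.
rewrite (sweedler_pure (f := fun x y => f (α x) (μ y))); last by multilinear.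
by rewrite hone_twist twistVK.
Qed.

Lemma coinvariantP v : coact M (μ v) = hone H ⊗ v -> coinvariant M v.
Proof.
move=> E; rewrite /coinvariant /=.
rewrite (sweedlerE (coact M v)) -[hone H]twistK hone_twist.
pose f (x : H) (y : M) := α' x ⊗ μ' y.
have fl : bilin f by rewrite /f; multilinear.
rewrite -[RHS]/(f (hone H) v) -(sweedler_pure _ _ fl) -E coacE //.
by apply: eq_bigr => p _; rewrite /f !twistK.
Qed.

Lemma coinvariant_twist v : coinvariant M v -> coinvariant M (μ v).
Proof.
move=> vc; apply: coinvariantP; rewrite (sweedlerE (coact M _)).
rewrite (coac_twist (f := fun x y => x ⊗ y)); last by multilinear.
rewrite (coac_coinvariant (f := fun x y => α x ⊗ μ y)) ?hone_twist //.
by multilinear.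
Qed.

(** * The projection onto the coinvariants *)

Definition coproj (m : M) : M := \sum_(p <- coac m) la (S p.1) p.2.

Lemma coproj_lin : lin coproj.
Proof. by rewrite /coproj; multilinear. Qed.

HB.instance Definition _ := GRing.isLinear.Build K M M *:%R coproj coproj_lin.

Local Hint Resolve coproj_lin : multilinear.

Lemma coproj_twist m : coproj (μ m) = μ (coproj m).
Proof.
rewrite /coproj (coac_twist (f := fun x y => la (S x) y)); last by multilinear.
by rewrite linear_sum; apply: eq_bigr => p _; rewrite twist_la antipode_twist.
Qed.

Lemma coproj_id v : coinvariant M v -> coproj v = v.
Proof.
move=> vc; rewrite /coproj (coac_coinvariant (f := fun x y => la (S x) y)) //.
  by rewrite antipode_one la1.
by multilinear.
Qed.

Lemma coprojE m : \sum_(p <- coac m) la p.1 (coproj p.2) = m.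
Proof.
pose T x y z := la (mul x (S y)) z.
have Tl : trilin T by rewrite /T; multilinear.
transitivity (\sum_(p <- coac m) \sum_(q <- coac p.2) T p.1 q.1 q.2).
  apply: eq_bigr => p _; rewrite linear_sumr.
  by apply: eq_bigr => q _; rewrite /T la_mul.
rewrite -(coac_coassoc _ Tl).
rewrite -[RHS](@coac_counit m _ id) //; apply: eq_bigr => p _.
by rewrite /T -linear_sumlz /= antipode_r_untwisted linearZl_LR /= la1.
Qed.

(** The coaction of m is Δ(m_(-1)) acting on 1 ⊗ P(m_(0)). This follows from [coprojE] and
    coassociativity alone, so it is available before P(m) is known to be coinvariant. *)
Lemma coac_coproj W (f : H -> M -> W) m : bilin f ->
  \sum_(p <- coac m) f p.1 p.2 =
  \sum_(p <- coac m) \sum_(q <- cop p.1) f q.1 (la q.2 (coproj p.2)).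
Proof.
move=> fl; rewrite (coac_coassoc (T := fun x y z => f x (la y (coproj z)))).
  apply: eq_bigr => p _; rewrite -[in LHS](coprojE p.2).
  exact: lin_sumE (fl.2 _).
by multilinear.
Qed.

(** By [coac_coproj] and multiplicativity of Δ, the coaction of P(m) is Δ(S(m_(-2)) m_(-1)) acting
    on 1 ⊗ P(m_(0)), which the antipode axiom reduces to 1 ⊗ P(m). No formula for Δ(S(h)) enters. *)
Lemma coproj_coinvariant m : coinvariant M (coproj m).
Proof.
apply: coinvariantP; rewrite (sweedlerE (coact M _)).
pose f (x : H) (y : M) := x ⊗ y.
have fl : bilin f by exact: bilinP.
pose T x y z := \sum_(u <- cop (mul (S x) y)) f u.1 (la u.2 (coproj z)).
have Tl : trilin T by rewrite /T; multilinear.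
transitivity (\sum_(p <- coac m) \sum_(q <- coac p.2) T p.1 q.1 q.2).
  rewrite (lin_sumE (g := fun n => \sum_(p <- coac n) f p.1 p.2));
    last by multilinear.
  apply: eq_bigr => p _; rewrite coac_la // exchange_big.
  rewrite (coac_coproj (f := fun x y => \sum_(a <- cop (S p.1))
    f (mul a.1 x) (la a.2 y))); last by multilinear.
  apply: eq_bigr => q _; rewrite /T.
  rewrite (cop_mul (f := fun x y => f x (la y (coproj q.2))));
    last by multilinear.
  rewrite exchange_big; apply: eq_bigr => a _.
  by apply: eq_bigr => b _; rewrite la_mul.
rewrite -(coac_coassoc _ Tl).
rewrite -[RHS](@coac_counit m _ (fun n => hone H ⊗ coproj n));
  last by multilinear.
apply: eq_bigr => p _; rewrite /T.
rewrite -(lin_sumE (g := fun h => \sum_(u <- cop h) f u.1 (la u.2 (coproj p.2)))).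
  rewrite antipode_l_untwisted.
  rewrite (linZ (f := fun h => \sum_(u <- cop h) f u.1 (la u.2 (coproj p.2)))).
    rewrite (cop_one (f := fun x y => f x (la y (coproj p.2))));
      last by multilinear.
    by rewrite la1.
  by multilinear.
by multilinear.
Qed.

Lemma coproj_la_coinvariant h v : coinvariant M v -> coproj (la h v) = ε h *: v.
Proof.
move=> vc; rewrite /coproj (coac_la (f := fun x y => la (S x) y));
  last by multilinear.
transitivity (\sum_(p <- cop h) la (mul (S p.1) p.2) v); last first.
  by rewrite -linear_sumlz antipode_l_untwisted linearZl_LR /= la1.
apply: eq_bigr => p _.
rewrite (coac_coinvariant (f := fun x y => la (S (mul p.1 x)) (la p.2 y))) //.
  by rewrite mul1r la_mul.
by multilinear.
Qed.

Lemma coproj_la h m : coproj (la h m) = ε h *: coproj m.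
Proof.
rewrite -[in LHS](coprojE m) linear_sumr linear_sum.
rewrite -(@coac_counit m _ coproj); last exact: coproj_lin.
rewrite scaler_sumr; apply: eq_bigr => p _ /=.
rewrite -la_mul coproj_la_coinvariant; last exact: coproj_coinvariant.
by rewrite counit_mul scalerA.
Qed.

Lemma coproj_ra m h : coproj (ra m h) = coproj (ra (coproj m) h).
Proof.
rewrite -[in LHS](coprojE m) linear_sumlz linear_sum.
rewrite -(@coac_counit m _ (fun n => coproj (ra (coproj n) h)));
  last by multilinear.
by apply: eq_bigr => p _; rewrite /= la_ra coproj_la.
Qed.

(** This is [coprojE] for vh, whose coaction is h_1 ⊗ v h_2 when v is coinvariant. *)
Lemma ra_coinvariant v h : coinvariant M v ->
  ra v h = \sum_(p <- cop h) la p.1 (coproj (ra v p.2)).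
Proof.
move=> vc; rewrite -[LHS]coprojE.
rewrite (coac_ra (f := fun x y => la x (coproj y))); last by multilinear.
rewrite (coac_coinvariant (f := fun x y =>
  \sum_(q <- cop h) la (mul x q.1) (coproj (ra y q.2)))) //;
    last by multilinear.
by apply: eq_bigr => q _; rewrite mul1l.
Qed.

Section InverseAntipode.
Variable SV : {linear H -> H}.
Hypotheses (SK : cancel S SV) (SVK : cancel SV S).

(** Write hv = h_1 P(v S^-1(h_3) h_2), pull P inside by [coproj_ra], and recognize [ra_coinvariant]
    for the coinvariant P(v S^-1(h_2)) acted on by h_1. *)
Lemma la_coinvariant h v : coinvariant M v ->
  la h v = \sum_(p <- cop h) ra (coproj (ra v (SV p.2))) p.1.
Proof.
move=> vc; pose T x y z := la x (coproj (ra v (mul (SV z) y))).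
have Tl : trilin T by rewrite /T; multilinear.
transitivity (\sum_(p <- cop h) \sum_(q <- cop p.1) T q.1 q.2 p.2).
  rewrite cop_coassoc // -[LHS](@cop_counit_r _ _ h _ (fun x => la x v)).
    apply: eq_bigr => p _; rewrite /T -linear_sumr -linear_sum -linear_sumr /=.
    by rewrite antipodeV_l // linearZr_LR /= ra1 linearZ linearZr_LR /= coproj_id.
  by multilinear.
apply: eq_bigr => p _; rewrite [RHS]ra_coinvariant; last exact: coproj_coinvariant.
by apply: eq_bigr => q _; rewrite /T ra_mul -coproj_ra.
Qed.

Lemma coproj_raV m :
  m = \sum_(p <- coac m) \sum_(q <- cop p.1) ra (coproj (ra p.2 (SV q.2))) q.1.
Proof.
rewrite -[LHS]coprojE; apply: eq_bigr => p _.
rewrite la_coinvariant; last exact: coproj_coinvariant.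
by apply: eq_bigr => q _; rewrite -coproj_ra.
Qed.

End InverseAntipode.
End UntwistBimodule.

(** * Finitely supported sums, coordinates and unique expansions *)

Section FiniteSupport.
Variables (K : fieldType) (I : choiceType).

Lemma finsuppP (A : zmodType) (c : I -> A) :
  finsupp_fun c <-> exists s : {fset I}, forall i, i \notin s -> c i = 0.
Proof.
split=> [fc|[s cs]].
  exists (fset_set [set i | c i != 0]) => i.
  by rewrite in_fset_set // notin_setE /= => /negP; rewrite negbK => /eqP.
apply: (sub_finite_set _ (finite_fset s)) => i /= ci.
by apply: contraNT ci => /cs ->.
Qed.

Lemma finsupp_comp (A B : zmodType) (c : I -> A) (g : I -> A -> B) :
  (forall i, g i 0 = 0) -> finsupp_fun c -> finsupp_fun (fun i => g i (c i)).
Proof.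
move=> g0 /finsuppP[s cs]; apply/finsuppP; exists s => i /cs ->; exact: g0.
Qed.

Lemma fsum_lin (U V : lmodType K) (g : U -> V) (F : I -> U) :
  lin g -> finsupp_fun F ->
  g (\sum_(i \in [set: I]) F i) = \sum_(i \in [set: I]) g (F i).
Proof.
move=> gl /finsuppP[s Fs]; rewrite (fsbigTE s) // (fsbigTE s).
  exact: lin_sumE.
by move=> i /Fs ->; rewrite -(scale0r 0) (linZ _ _ gl) scale0r.
Qed.

Lemma fsum_linform (V : lmodType K) (g : V -> K) (c : I -> K) (e : I -> V) :
  linform g -> finsupp_fun c ->
  \sum_(i \in [set: I]) c i * g (e i) = g (\sum_(i \in [set: I]) c i *: e i).
Proof.
move=> gl /finsuppP[s cs]; rewrite (fsbigTE s); last first.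
  by move=> i /cs ->; rewrite mul0r.
rewrite (fsbigTE s); last by move=> i /cs ->; rewrite scale0r.
(* The functional is viewed as a linear map into the regular module. *)
rewrite (lin_sumE (g := g : V -> K^o)) //.
by apply: eq_bigr => i _; rewrite (linZ (f := g : V -> K^o)).
Qed.

Section Coordinates.
Variables (V : lmodType K) (W : set V) (e : I -> V).
Hypothesis eW : linear_basis W e.

Definition coord (v : V) : I -> K :=
  xget (fun=> 0)
    [set c | finsupp_fun c /\ v = \sum_(i \in [set: I]) c i *: e i].

Lemma coordP v : W v ->
  finsupp_fun (coord v) /\ v = \sum_(i \in [set: I]) coord v i *: e i.
Proof.
case: eW => _ _ span /span[c cf vE].
by have := @xgetPex _ (fun=> 0) [set c | _] (ex_intro _ c (conj cf vE)).
Qed.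

Lemma coord_unique v c : W v -> finsupp_fun c ->
  v = \sum_(i \in [set: I]) c i *: e i -> coord v = c.
Proof.
case: (eW) => _ free _ /coordP[/finsuppP[s cs] vE] /finsuppP[t ct] vE'.
apply/funext => i; apply/eqP; rewrite -subr_eq0; apply/eqP.
have out j : j \notin (s `|` t)%fset -> (coord v j = 0) * (c j = 0).
  by rewrite inE negb_or => /andP[/cs -> /ct ->].
apply: (free (fun i => coord v i - c i)).
  by apply/finsuppP; exists (s `|` t)%fset => j /out[-> ->]; rewrite subr0.
rewrite (fsbigTE (s `|` t)%fset); last first.
  by move=> j /out[-> ->]; rewrite subr0 scale0r.
under eq_bigr => j _ do rewrite scalerBl.
rewrite sumrB -!(fsbigTE (s `|` t)%fset) -?vE -?vE' ?subrr //.
  by move=> j /out[_ ->]; rewrite scale0r.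
by move=> j /out[-> _]; rewrite scale0r.
Qed.

Lemma coord_lin (U : lmodType K) (g : U -> V) i :
  (forall u, W (g u)) -> lin g -> linform (fun u => coord (g u) i).
Proof.
move=> gW gl a x y.
have [/finsuppP[s cs] xE] := coordP (gW x).
have [/finsuppP[t ct] yE] := coordP (gW y).
have out j : j \notin (s `|` t)%fset -> (coord (g x) j = 0) * (coord (g y) j = 0).
  by rewrite inE negb_or => /andP[/cs -> /ct ->].
rewrite (@coord_unique _ (fun i => a * coord (g x) i + coord (g y) i)) //.
  by apply/finsuppP; exists (s `|` t)%fset => j /out[-> ->]; rewrite mulr0 addr0.
rewrite (fsbigTE (s `|` t)%fset); last first.
  by move=> j /out[-> ->]; rewrite mulr0 addr0 scale0r.
under eq_bigr => j _ do rewrite scalerDl -scalerA.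
rewrite big_split -scaler_sumr gl [in LHS]xE [in LHS]yE /=.
congr (_ *: _ + _); apply: fsbigTE => j /out[E E']; by rewrite ?E ?E' scale0r.
Qed.

Lemma coord_basis i j : coord (e j) i = (i == j)%:R.
Proof.
have jW : W (e j) by case: eW.
rewrite (@coord_unique _ (fun i => (i == j)%:R)) //.
  apply/finsuppP; exists [fset j]%fset => k; rewrite inE => /negPf -> //.
rewrite (fsbigTE [fset j]%fset); last first.
  by move=> k; rewrite inE => /negPf ->; rewrite scale0r.
by rewrite big_seq_fset1 eqxx scale1r.
Qed.

Lemma basis_expand (U X : lmodType K) (a : U -> V -> X) (T : Type)
    (s : seq T) (u : T -> U) (w : T -> V) :
  bilin a -> (forall x, W (w x)) ->
  finsupp_fun (fun i => \sum_(x <- s) coord (w x) i *: u x) /\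
  \sum_(x <- s) a (u x) (w x) =
  \sum_(i \in [set: I]) a (\sum_(x <- s) coord (w x) i *: u x) (e i).
Proof.
move=> al wW.
have a0 v : a 0 v = 0 by rewrite -(scale0r 0) (linZ _ _ (al.1 v)) scale0r.
elim: s => [|x s [/finsuppP[A As] IH]].
  split; first by apply/finsuppP; exists fset0 => i; rewrite big_nil.
  by rewrite big_nil fsbig1 // => i _; rewrite big_nil.
have [/finsuppP[B Bs] wE] := coordP (wW x).
have out i : i \notin (A `|` B)%fset ->
    (\sum_(x <- s) coord (w x) i *: u x = 0) * (coord (w x) i = 0).
  by rewrite inE negb_or => /andP[/As -> /Bs ->].
split.
  apply/finsuppP; exists (A `|` B)%fset => i /out[E E'].
  by rewrite big_cons E E' scale0r addr0.
rewrite big_cons IH [in LHS]wE.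
rewrite !(fsbigTE (A `|` B)%fset); first last.
- by move=> i /out[_ ->]; rewrite scale0r.
- by move=> i /out[-> _]; rewrite a0.
- by move=> i /out[E E']; rewrite big_cons E E' scale0r addr0 a0.
rewrite (lin_sumE _ _ (al.2 _)) -big_split /=; apply: eq_bigr => i _.
by rewrite big_cons al.1 (linZ _ _ (al.2 _)).
Qed.

(** Common core of left and right freeness: [theta] is a family of coefficient maps dual to the
    basis, which forces uniqueness, while any expression through elements of W can be regrouped
    along the basis by [basis_expand]. *)
Lemma unique_expansion (U : lmodType K) (a : U -> V -> V) (theta : I -> V -> U) :
  bilin a -> (forall i, lin (theta i)) ->
  (forall i j h, theta i (a h (e j)) = (i == j)%:R *: h) ->
  (forall v, exists (T : Type) (s : seq T) (u : T -> U) (w : T -> V),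
     (forall x, W (w x)) /\ v = \sum_(x <- s) a (u x) (w x)) ->
  forall v, exists! h : I -> U,
    finsupp_fun h /\ v = \sum_(i \in [set: I]) a (h i) (e i).
Proof.
move=> al thl thE span v.
have uniq h : finsupp_fun h -> v = \sum_(i \in [set: I]) a (h i) (e i) ->
    forall i, h i = theta i v.
  move=> hf -> i; rewrite fsum_lin //; last first.
    apply: (@finsupp_comp _ _ _ (fun i x => a x (e i))) hf => j.
    by rewrite -(scale0r 0) (linZ _ _ (al.1 _)) scale0r.
  rewrite (fsbigTE [fset i]%fset); last first.
    by move=> k; rewrite inE eq_sym thE => /negPf ->; rewrite scale0r.
  by rewrite big_seq_fset1 thE eqxx scale1r.
have [T [s [u [w [wW vE]]]]] := span v.
have [hf hE] := basis_expand s u al wW.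
exists (fun i => \sum_(x <- s) coord (w x) i *: u x); split.
  by split; rewrite // vE.
move=> h [h_fin hvE]; apply/funext => i.
by rewrite (uniq h) // (uniq (fun i => \sum_(x <- s) coord (w x) i *: u x)) // vE.
Qed.

End Coordinates.
End FiniteSupport.

(** * Freeness on both sides and the structure functionals *)

Section Bases.
Variables (K : fieldType) (H : monHomHopf K) (M : leftCovBimodule H).
Variables (I : choiceType) (e : I -> M).
Hypothesis e_basis : linear_basis (coinvariant M) e.
Local Notation α := (twist H).
Local Notation α' := (twistV H).
Local Notation μ := (twist M).
Local Notation μ' := (twistV M).
Local Notation S := (antipode H).
Local Notation ε := (hcounit H).
Local Notation cop h := (sweedler (hcomul H (α h))).
Local Notation coac m := (sweedler (coact M (μ m))).
Local Notation la := (@la K H M).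
Local Notation ra := (@ra K H M).
Local Notation coproj := (@coproj K H M).
Implicit Types m v : M.

Local Hint Resolve la_bilin ra_bilin mul_bilin coproj_lin : multilinear.

Lemma coord_coproj_linear i : scalar (fun m : M => coord e (coproj m) i).
Proof.
apply: (coord_lin e_basis) => [m|]; first exact: coproj_coinvariant.
exact: coproj_lin.
Qed.

Definition cocoord (i : I) : {scalar M} :=
  HB.pack (fun m : M => coord e (coproj m) i)
    (GRing.isLinear.Build K M K *%R _ (coord_coproj_linear i)).

Lemma basis_coinvariant i : coinvariant M (e i).
Proof. by case: e_basis. Qed.

Lemma cocoord_basis i j : cocoord i (e j) = (i == j)%:R.
Proof.
by rewrite /cocoord /= coproj_id ?(coord_basis e_basis) //; exact: basis_coinvariant.
Qed.

Lemma cocoord_finsupp m : finsupp_fun (cocoord^~ m).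
Proof. exact: (coordP e_basis (coproj_coinvariant m)).1. Qed.

Lemma cocoordE m :
  \sum_(i \in [set: I]) cocoord i m *: e i = coproj m.
Proof. exact/esym/(coordP e_basis (coproj_coinvariant m)).2. Qed.

Lemma cocoord_coproj i m : cocoord i (coproj m) = cocoord i m.
Proof. by rewrite /cocoord /= (coproj_id (coproj_coinvariant m)). Qed.

Lemma cocoord_la i h m : cocoord i (la h m) = ε h * cocoord i m.
Proof.
rewrite -cocoord_coproj coproj_la linearZ.
exact: congr1 (cocoord_coproj i m).
Qed.

Lemma sum_coproj_expand (X : lmodType K) (a : H -> M -> X) (T : Type)
    (s : seq T) (u : T -> H) (w : T -> M) : bilin a ->
  \sum_(x <- s) a (u x) (coproj (w x)) =
  \sum_(i \in [set: I]) a (\sum_(x <- s) cocoord i (w x) *: u x) (e i).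
Proof.
move=> al.
have wW x : coinvariant M (coproj (w x)) by exact: coproj_coinvariant.
exact: (basis_expand e_basis s u al wW).2.
Qed.

Lemma free_left : free_left_basis e.
Proof.
(* The inverse twist converts the given action [lact] back into [la]. *)
pose theta i m := \sum_(p <- coac (μ' m)) cocoord i p.2 *: p.1.
apply: (unique_expansion e_basis (theta := theta)).
- exact: bilinP.
- by move=> i; rewrite /theta; multilinear.
- move=> i j h; rewrite /theta -/(la h (e j)).
  rewrite (coac_la (f := fun x y => cocoord i y *: x)); last by multilinear.
  transitivity (\sum_(p <- cop h) ε p.2 *: ((i == j)%:R *: p.1)); last first.
    by apply: (cop_counit_r _ (g := fun x => (i == j)%:R *: x)); multilinear.
  apply: eq_bigr => p _.
  rewrite (coac_coinvariant (f := fun x y => cocoord i (la p.2 y) *: mul p.1 x)).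
  + by rewrite mul1r cocoord_la cocoord_basis scalerA.
  + exact: basis_coinvariant.
  + by multilinear.
move=> m; exists _, (coac (μ' m)), (fun p => p.1), (fun p => coproj p.2).
split=> [p|]; first exact: coproj_coinvariant.
rewrite -[LHS](twistVK m) -[in LHS](coprojE (μ' m)) linear_sum.
by apply: eq_bigr => p _; rewrite lactE.
Qed.

Lemma free_right (SV : {linear H -> H}) (SK : cancel S SV)
  (SVK : cancel SV S) : free_right_basis e.
Proof.
pose theta i m := \sum_(p <- coac (μ' m)) \sum_(q <- cop p.1)
  cocoord i (ra p.2 (SV q.2)) *: q.1.
apply: (unique_expansion e_basis (a := fun h m => ract M m h) (theta := theta)).
- by multilinear.
- by move=> i; rewrite /theta; multilinear.
- move=> i j h; rewrite /theta -/(ra (e j) h).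
  pose G x y := \sum_(q <- cop x) cocoord i (ra y (SV q.2)) *: q.1.
  have Gl : bilin G by rewrite /G; multilinear.
  rewrite (coac_ra _ _ Gl).
  rewrite (coac_coinvariant (f := fun x y =>
    \sum_(q <- cop h) G (mul x q.1) (ra y q.2))); first last.
  + by multilinear.
  + exact: basis_coinvariant.
  (* Since e_j h has coaction h_1 ⊗ e_j h_2, its image under [theta i] is h_1 c_i(P(e_j h_3
     S^-1(h_2))); coassociativity brings h_3 S^-1(h_2) together for [antipodeV_r]. *)
  pose T (x y z : H) := cocoord i (ra (e j) (mul z (SV y))) *: x.
  have Tl : trilin T by rewrite /T; multilinear.
  transitivity (\sum_(p <- cop h) \sum_(q <- cop p.1) T q.1 q.2 p.2).
    apply: eq_bigr => p _; rewrite mul1l.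
    by apply: eq_bigr => q _; rewrite /T ra_mul.
  rewrite (cop_coassoc _ Tl).
  transitivity (\sum_(p <- cop h) ε p.2 *: ((i == j)%:R *: p.1)); last first.
    by apply: (cop_counit_r _ (g := fun x => (i == j)%:R *: x)); multilinear.
  apply: eq_bigr => p _; rewrite scalerA -cocoord_basis -[_ * _]linearZ.
  rewrite /T -scaler_suml -linear_sum -linear_sumr; congr (cocoord i _ *: _).
  by rewrite antipodeV_r // linearZr_LR /= ra1.
move=> m.
(* The double sum of [coproj_raV] is flattened into one sequence of coinvariants with right
   coefficients. *)
exists _, [seq (p, q) | p <- coac (μ' m), q <- cop p.1], (fun x => x.2.1),
  (fun x => coproj (ra x.1.2 (SV x.2.2))).
split=> [x|]; first exact: coproj_coinvariant.
rewrite big_allpairs_dep -[LHS](twistVK m) [in LHS](coproj_raV SK SVK (μ' m)).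
rewrite linear_sum; apply: eq_bigr => p _; rewrite linear_sum.
by apply: eq_bigr => q _; rewrite ractE.
Qed.

Definition structure_functional (i j : I) : {scalar H} :=
  [the {scalar H} of cocoord j \o ract M (e i)].

Lemma coproj_ract m h : coproj (ract M m h) = coproj (ract M (coproj m) h).
Proof. by rewrite !ractE !coproj_twist coproj_ra. Qed.

Lemma structure_functional_sum (c : I -> K) k h : finsupp_fun c ->
  \sum_(j \in [set: I]) c j * structure_functional j k h =
  cocoord k (ract M (\sum_(j \in [set: I]) c j *: e j) h).
Proof.
move=> cf; apply: (fsum_linform (g := fun n => cocoord k (ract M n h))) cf.
by multilinear.
Qed.

(** The factor [mubar] replaces e_i by its inverse twist, which changes the given right action into
    the untwisted one, evaluated at [α h]. *)
Lemma structure_functional_twistV i k (mubar : I -> I -> K) h :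
  finsupp_fun (mubar i) ->
  μ' (e i) = \sum_(j \in [set: I]) mubar i j *: e j ->
  \sum_(j \in [set: I]) mubar i j * structure_functional j k h =
  cocoord k (ra (e i) (α h)).
Proof.
move=> bf bE; rewrite structure_functional_sum // -bE.
by rewrite ractE twist_ra twistVK.
Qed.

End Bases.

Theorem theorem4p17 (K : fieldType) (H : monHomHopf K)
  (SV : H -> H) (SK : cancel (antipode H) SV) (SVK : cancel SV (antipode H))
  (M : leftCovBimodule H) (I : choiceType) (m : I -> M)
  (m_basis : linear_basis (coinvariant M) m)
  (mu mubar : I -> I -> K)
  (mu_fin : forall i, finsupp_fun (mu i))
  (muE : forall i, twist M (m i) = \sum_(j \in [set: I]) mu i j *: m j)
  (mubar_fin : forall i, finsupp_fun (mubar i))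
  (mubarE : forall i, twistV M (m i) = \sum_(j \in [set: I]) mubar i j *: m j) :
  free_left_basis m /\
  exists f : I -> I -> {scalar H},
    pointwise_finite f /\
    (forall i k h g,
      \sum_(j \in [set: I]) mu i j * f j k (hmul H h g) =
      \sum_(j \in [set: I]) f i j h * f j k (twist H g)) /\
    (forall i j, f i j (hone H) = mu i j) /\
    (forall i h,
      ract M (m i) h =
      \sum_(k \in [set: I])
        lact M (bullet (fun x => \sum_(j \in [set: I]) mubar i j * f j k x)
                     (twistV H h)) (m k)) /\
    free_right_basis m /\
    (forall i h,
      lact M h (m i) =
      \sum_(j \in [set: I])
        ract M (m j) (bullet (fun x => \sum_(k \in [set: I])
                                       mubar i k * f k j (SV x))
                           (twistV H h))).
Proof.
(* The inverse of a linear bijection is linear, so [SV] can enter the multilinear calculus. *)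
have SVl : linear SV.
  by move=> a x y; apply: (can_inj SK); rewrite linearP !SVK.
pose SV' : {linear H -> H} := HB.pack SV (GRing.isLinear.Build _ _ _ _ SV SVl).
have sumE i k h := structure_functional_twistV m_basis k h (mubar_fin i) (mubarE i).
split; first exact: free_left.
exists (fun i j => structure_functional m_basis i j).
split=> [i h|]; first exact: cocoord_finsupp.
split=> [i k h g|].
  (* Both sides are the k-th coordinate of P((m_i h) α(g)): the left one by associativity, the right
     one after replacing m_i h by its projection. *)
  rewrite !structure_functional_sum //; last exact: cocoord_finsupp.
  rewrite (cocoordE m_basis) -muE -ract_assoc -[LHS](cocoord_coproj m_basis) coproj_ract.
  by rewrite cocoord_coproj.
split=> [i j|].
  (* m_i 1 is the twist of m_i; being coinvariant, it is fixed by P, and its coordinates are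
     unique. *)
  have mc := coinvariant_twist (basis_coinvariant m_basis i).
  by rewrite /= ract1 coproj_id // (coord_unique m_basis mc (mu_fin i) (muE i)).
split=> [i h|].
  rewrite ractE ra_coinvariant; last exact: basis_coinvariant.
  rewrite linear_sum.
  transitivity (\sum_(p <- sweedler (hcomul H (twist H h)))
      lact M p.1 (coproj (ra (m i) p.2))).
    by apply: eq_bigr => p _; rewrite lactE.
  rewrite (sum_coproj_expand m_basis); last exact: bilinP.
  apply: eq_fsbigr => k _; congr (lact M _ _).
  rewrite (_ : (fun x => _) = fun x => cocoord m_basis k (ra (m i) (twist H x))).
    rewrite bulletE; last by multilinear.
    by apply: eq_bigr => p _; rewrite twistVK.
  by apply/funext => x; exact: sumE.
split; first exact: (free_right m_basis (SV := SV')).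
move=> i h.
rewrite lactE (la_coinvariant (SV := SV') SK SVK); last exact: basis_coinvariant.
rewrite linear_sum.
transitivity (\sum_(p <- sweedler (hcomul H (twist H h)))
    ract M (coproj (ra (m i) (SV' p.2))) p.1).
  by apply: eq_bigr => p _; rewrite ractE.
rewrite (sum_coproj_expand m_basis (a := fun x y => ract M y x));
  last by multilinear.
apply: eq_fsbigr => k _; congr (ract M _ _).
(* The twist produced by [mubar] cancels the inverse twist from [bulletE], once the latter is moved
   through S^-1. *)
rewrite (_ : (fun x => _) =
    fun x => cocoord m_basis k (ra (m i) (twist H (SV' x)))).
  rewrite bulletE; last by multilinear.
  apply: eq_bigr => p _.
  by rewrite (antipodeV_twistV (SV := SV') SK SVK) twistVK.
by apply/funext => x; exact: sumE.
Qed.
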